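(* Let $\theta_0=\arg\min_{\theta\in\Theta}\mathbb E[\ell(\theta,Z)]\in\mathbb R^p$, let $D_m=\{Z_1,\ldots,Z_m\}$ be the observed data, and consider the stochastic gradient descent iterates, started from a fixed initial value $\widehat\theta_0$, $$\widehat\theta_n=\widehat\theta_{n-1}-\gamma_n\nabla\ell(\widehat\theta_{n-1},Z_n),\qquad \overline\theta_n=\frac1n\sum_{i=1}^n\widehat\theta_i,\qquad 1\le n\le m,$$ with learning rates $\gamma_n=\gamma_1n^{-\tau}$, $\gamma_1>0$, $\tau\in(0.5,1)$. For $b=1,\ldots,B$ let $\{W_{i,b}:1\le i\le m\}$ be i.i.d. non-negative random variables with mean and variance equal to $1$, independent across $b$ and independent of the data, and define perturbed iterates, started from $\widehat\theta_0^{*b}=\widehat\theta_0$, $$\widehat\theta_n^{*b}=\widehat\theta_{n-1}^{*b}-\gamma_nW_{n,b}\nabla\ell(\widehat\theta_{n-1}^{*b},Z_n),\qquad\overline\theta_n^{*b}=\frac1n\sum_{i=1}^n\widehat\theta_i^{*b}.$$ Fix a coordinate, and from now on let $\theta_0,\overline\theta_m,\overline\theta_m^{*b}$ denote that (real) coordinate of the corresponding vectors; let $\overline\theta^*_{(1)}\le\cdots\le\overline\theta^*_{(B)}$ be the order statistics of $\{\overline\theta_m^{*b}\}_{b=1}^B$. For $\alpha\in(0,1)$ define $$\mathrm{CI}=\Big(2\overline\theta_m-\overline\theta^*_{(\lceil(B+1)(1-\alpha)\rceil+\lfloor(B+1)(\alpha/2)\rfloor)},\ 2\overline\theta_m-\overline\theta^*_{(\lfloor(B+1)(\alpha/2)\rfloor)}\Big].$$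 With $F_0(D_m)=\mathbb P(\overline\theta_m^{*b}\le2\overline\theta_m-\theta_0\mid D_m)$ (which does not depend on $b$), $$\Big|\mathbb P(\theta_0\in\mathrm{CI})-\frac{\lceil(B+1)(1-\alpha)\rceil}{B+1}\Big|\le\widetilde d_{\mathrm{KS}}(F_0(D_m),U(0,1)),$$ and consequently $$-\widetilde d_{\mathrm{KS}}(F_0(D_m),U(0,1))\le\mathbb P(\theta_0\in\mathrm{CI})-(1-\alpha)\le\frac1{B+1}+\widetilde d_{\mathrm{KS}}(F_0(D_m),U(0,1)).$$
   Context: All maps are assumed measurable. For real random variables, $\widetilde d_{\mathrm{KS}}(Y_1,Y_2)=\sup_{s,t\in\mathbb R}|\mathbb P(Y_1\in(s,t])-\mathbb P(Y_2\in(s,t])|$; $U(0,1)$ denotes a standard uniform random variable. Conventions: $\overline\theta^*_{(0)}=-\infty$ and $\overline\theta^*_{(B+1)}=+\infty$ (the corresponding endpoint constraint is vacuous). $\nabla\ell$ is the gradient (or a subgradient) in $\theta$. *)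

(* Defs.v *)
From HB Require Import structures.
From mathcomp Require Export all_boot all_order all_algebra.
From mathcomp Require Export all_classical all_reals all_analysis.
Export Order.TTheory GRing.Theory Num.Theory.
Export numFieldNormedType.Exports.
Set Implicit Arguments.
Unset Strict Implicit.
Unset Printing Implicit Defensive.
#[global] Open Scope classical_set_scope.
#[global] Open Scope ring_scope.

Definition minimizers (T : Type) (R : realType) (A : set T) (f : T -> \bar R) :
  set T := [set x | A x /\ forall y, A y -> (f x <= f y)%E].

Definition dotv (R : realType) (p : nat) (u v : 'rV[R]_p) : R :=
  \sum_(k < p) u ord0 k * v ord0 k.

Definition is_gradient (R : realType) (p : nat) (f : 'rV[R]_p -> R)
    (x v : 'rV[R]_p) : Prop :=
  differentiable (f : 'rV[R]_p -> R^o) x /\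
  forall h, 'd (f : 'rV[R]_p -> R^o) x h = dotv v h.

Definition is_subgradient (R : realType) (p : nat) (f : 'rV[R]_p -> R)
    (x v : 'rV[R]_p) : Prop :=
  forall y, f x + dotv v (y - x) <= f y.

(* 'rV[R]_p carries no canonical sigma-algebra; measurability in a vector
   argument is expressed through p.-tuple R, whose product sigma-algebra is the
   Borel one. *)
Definition row_of_tuple (R : realType) (p : nat) (x : p.-tuple R) : 'rV[R]_p :=
  \row_k tnth x k.

Definition learning_rate (R : realType) (gamma1 tau : R) (n : nat) : R :=
  gamma1 * (n%:R `^ (- tau)).

(* Only a n and z n with n >= 1 are used. *)
Fixpoint sgd (R : realType) (p : nat) (T : Type)
    (grad : 'rV[R]_p -> T -> 'rV[R]_p) (init : 'rV[R]_p)
    (a : nat -> R) (z : nat -> T) (n : nat) : 'rV[R]_p :=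
  if n is n'.+1 then
    let x := sgd grad init a z n' in x - a n *: grad x (z n)
  else init.

Definition average (R : realType) (p : nat) (x : nat -> 'rV[R]_p) (n : nat) :
  'rV[R]_p := n%:R^-1 *: \sum_(1 <= i < n.+1) x i.

(* k-th smallest value, for 1 <= k <= B, of x_1, ..., x_B; -oo for k <= 0 and
   +oo for k > B. *)
Definition order_stat (R : realType) (B : nat) (x : 'I_B -> R) (k : int) :
  \bar R :=
  if k <= 0 then -oo%E
  else if k <= B%:Z then (nth 0 (sort <=%O (codom x)) (absz k).-1)%:E
  else +oo%E.

(* The interval (2 c - x_(hi), 2 c - x_(lo)], as a set of reals: an infinite
   endpoint imposes no constraint. *)
Definition bootstrap_CI (R : realType) (B : nat) (c : R) (x : 'I_B -> R)
    (alpha : R) : set R :=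
  let lo := Num.floor (B.+1%:R * (alpha / 2)) in
  let hi := Num.ceil (B.+1%:R * (1 - alpha)) + lo in
  [set y | ((2 * c)%:E - order_stat x hi < y%:E)%E /\
           (y%:E <= (2 * c)%:E - order_stat x lo)%E].

(* The distance depends on the two variables through their laws mu, nu only. *)
Definition ks_dist (R : realType) (mu nu : set R -> \bar R) : R :=
  sup [set r | exists s t : R,
    r = `|fine (mu `]s, t]%classic) - fine (nu `]s, t]%classic)| ].

(* For a finite family the product rule over the whole index set contains the
   rules over its subfamilies (take A i := setT). *)
Definition mutually_independent (d d' : measure_display)
    (Omega : measurableType d) (T : measurableType d') (R : realType)
    (P : probability Omega R) (I : finType) (X : I -> Omega -> T) : Prop :=
  forall A : I -> set T, (forall i, measurable (A i)) ->
    P [set w | forall i, A i (X i w)] = (\prod_(i : I) P (X i @^-1` A i))%E.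

Definition independent (d d1 d2 : measure_display)
    (Omega : measurableType d) (T1 : measurableType d1)
    (T2 : measurableType d2) (R : realType) (P : probability Omega R)
    (X : Omega -> T1) (Y : Omega -> T2) : Prop :=
  forall (A1 : set T1) (A2 : set T2), measurable A1 -> measurable A2 ->
    P (X @^-1` A1 `&` Y @^-1` A2) = (P (X @^-1` A1) * P (Y @^-1` A2))%E.

Definition identically_distributed (d d' : measure_display)
    (Omega : measurableType d) (T : measurableType d') (R : realType)
    (P : probability Omega R) (X Y : Omega -> T) : Prop :=
  forall A : set T, measurable A -> P (X @^-1` A) = P (Y @^-1` A).

(* F \o D is a version of the conditional probability P(E | D). *)
Definition cond_prob_version (d d' : measure_display)
    (Omega : measurableType d) (T : measurableType d') (R : realType)
    (P : probability Omega R) (D : Omega -> T) (E : set Omega)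
    (F : T -> R) : Prop :=
  [/\ measurable_fun [set: T] F,
      P.-integrable [set: Omega] (fun w => (F (D w))%:E) &
      forall A : set T, measurable A ->
        (\int[P]_(w in D @^-1` A) (F (D w))%:E = P (E `&` D @^-1` A))%E].

(* Main.v *)
(* Let N be the number of perturbed averages at most 2 thbar - theta0. By the
   meaning of the order statistics, theta0 lies in the confidence interval iff
   lo <= N < hi, where hi - lo = ceil ((B + 1) (1 - alpha)). Conditionally on
   the data, the weights of the B replicates are i.i.d., so N is binomial with
   parameters B and p = F0(D_m), and the coverage probability is E g(p), where
   g = sum_(lo <= k < hi) 'C(B, k) x^k (1 - x)^(B - k).

   For p uniform, each Bernstein polynomial integrates to 1 / (B + 1), hence
   E g(p) = (hi - lo) / (B + 1). In general, g' changes sign at most once on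
   [0, 1], from plus to minus, because its two Bernstein terms have a monotone
   ratio; so the superlevel sets of g on [0, 1] are closed intervals, on which
   the law of p and the uniform law differ by at most the Kolmogorov-Smirnov
   distance. As 0 <= g <= 1, the layer cake formula bounds the difference of
   the two expectations by the same distance. *)

From HB Require Import structures.
Require Import Defs.
From mathcomp Require Import measurable_realfun.
From mathcomp Require Import lra.

Set Implicit Arguments.
Unset Strict Implicit.
Unset Printing Implicit Defensive.

(** * Order statistics and Bernstein polynomials *)

Lemma nth_sort_le (R : realType) (s : seq R) (c : R) (k : nat) :
  (k < size s)%N -> (nth 0 (sort <=%O s) k <= c) = (k < count (<= c)%O s)%N.
Proof.
move=> ks; have ss : sorted <=%O (sort <=%O s) by exact: sort_le_sorted.
rewrite -(count_sort <=%O); have [kc|kc] := ltnP.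
  exact: nth_count_le.
apply/negbTE; rewrite -ltNge; apply: nth_count_gt => //.
by rewrite kc size_sort.
Qed.

(** The k-th smallest value is at most [c] exactly when at least k of the values are. The count lies
    between 0 and [B], so the infinite conventions fit and every integer [k] is covered. *)
Lemma order_stat_le (R : realType) (B : nat) (x : 'I_B -> R) (k : int) (c : R) :
  (order_stat x k <= c%:E)%E = (k <= #|[set b | x b <= c]%SET|%:Z).
Proof.
have cE : count (<= c)%O (codom x) = #|[set b | x b <= c]%SET|.
  rewrite cardsE cardE /enum_mem size_filter codomE count_map enumT.
  by apply: eq_count => b; rewrite /= ?inE.
rewrite /order_stat; case: ifPn => [k0|]; first by rewrite leNye (le_trans k0).
rewrite -ltNge => k0; case: ifPn => [kB|].
  case: k k0 kB => // -[//|k] _ kB; rewrite lee_fin /= nth_sort_le ?cE//.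
  by rewrite size_codom card_ord.
rewrite -ltNge => Bk; rewrite leye_eq /=; apply/esym/negbTE.
rewrite -ltNge (le_lt_trans _ Bk)// lez_nat (leq_trans (max_card _))//.
by rewrite card_ord.
Qed.

(** Reflection in [c] turns each endpoint constraint on [y] into a comparison of an order statistic
    with [2 * c - y], also at infinite endpoints. The open endpoint gives a negated comparison,
    hence the strict bound by [hi]. *)
Lemma bootstrap_CIP (R : realType) (B : nat) (c : R) (x : 'I_B -> R)
    (alpha y : R) :
  let lo := Num.floor (B.+1%:R * (alpha / 2)) in
  let hi := Num.ceil (B.+1%:R * (1 - alpha)) + lo in
  bootstrap_CI c x alpha y <->
  lo <= #|[set b | x b <= 2 * c - y]%SET|%:Z < hi.
Proof.
move=> lo hi; rewrite /bootstrap_CI /= -/lo -/hi.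
have sub_le (a : \bar R) :
    (y%:E <= (2 * c)%:E - a)%E = (a <= (2 * c - y)%:E)%E.
  case: a => [a| |]; last by rewrite leNye leey.
    by rewrite -EFinB !lee_fin; apply/idP/idP => ?; lra.
  by rewrite !leye_eq leeNy_eq.
have sub_lt (a : \bar R) :
    ((2 * c)%:E - a < y%:E)%E = ~~ (a <= (2 * c - y)%:E)%E.
  by rewrite -sub_le ltNge.
rewrite sub_le sub_lt !order_stat_le -ltNge.
by split => [[-> ->]|/andP[-> ->]].
Qed.

Section bernstein.
Variable R : realType.
Implicit Types (n k l h : nat) (u v x y z : R).

Definition bernstein n k : {poly R} :=
  ('X^k * (1 - 'X) ^+ (n - k)) *+ 'C(n, k).

(** The Bernstein polynomial of index [k - 1], with value 0 at index -1, so that the derivative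
    formula and its telescoping include [k = 0]. *)
Let bernstein_pred n k : {poly R} :=
  if k is k'.+1 then bernstein n k' else 0.

Lemma hornerbernstein n k x :
  (bernstein n k).[x] = x ^+ k * (1 - x) ^+ (n - k) *+ 'C(n, k).
Proof.
by rewrite /bernstein hornerMn hornerM hornerXn horner_exp hornerD hornerN
  hornerX -polyC1 hornerC.
Qed.

Lemma bernstein_ge0 n k x : 0 <= x <= 1 -> 0 <= (bernstein n k).[x].
Proof.
move=> /andP[x0 x1]; rewrite hornerbernstein mulrn_wge0// mulr_ge0//.
  exact: exprn_ge0.
by rewrite exprn_ge0// subr_ge0.
Qed.

Lemma sum_bernstein n : \sum_(0 <= k < n.+1) bernstein n k = 1.
Proof.
transitivity ((1 - 'X + 'X : {poly R}) ^+ n); last by rewrite subrK expr1n.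
rewrite exprDn big_mkord; apply: eq_bigr => k _.
by rewrite /bernstein mulrC.
Qed.

Lemma deriv_bernstein n k :
  (bernstein n.+1 k)^`() = (bernstein_pred n k - bernstein n k) *+ n.+1.
Proof.
rewrite /bernstein derivMn derivM derivXn deriv_exp derivB derivX.
rewrite -polyC1 derivC sub0r.
case: k => [|k] /=.
  rewrite !bin0 !subn0 mulr0n mul0r add0r expr0 !mul1r sub0r.
  by rewrite !mulr1n mulN1r.
have [nk|kn] := ltnP n k.
  by rewrite /bernstein !bin_small ?mulr0n ?subrr ?mul0rn// leqW.
(* The two terms match by the absorption identities (k+1) C(n+1,k+1) = (n+1) C(n,k) and (n-k)
   C(n+1,k+1) = (n+1) C(n,k+1). *)
rewrite subSS mulrnDl mulrnBl; congr (_ + _).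
  rewrite mulrnAl /bernstein -!mulrnA; congr (_ *+ _).
  by rewrite [RHS]mulnC (mul_bin_diag n.+1).
rewrite mulN1r mulNrn mulrN mulNrn mulrnAr -!mulrnA; congr (- _).
have -> : (n - k).-1 = (n - k.+1)%N by rewrite subnS.
congr (_ *+ _).
by rewrite [RHS]mulnC (mul_bin_down n.+1) subSS.
Qed.

Lemma deriv_sum_bernstein n l h : (l <= h)%N ->
  (\sum_(l <= k < h) bernstein n.+1 k)^`() =
  (bernstein_pred n l - bernstein_pred n h) *+ n.+1.
Proof.
move=> lh; rewrite raddf_sum /=.
under eq_bigr do rewrite deriv_bernstein -opprB mulNrn.
by rewrite sumrN sumrMnl (telescope_sumr (bernstein_pred n))// -mulNrn opprB.
Qed.

(** On (0, 1) the difference is a positive weight times a nonincreasing function, so nonnegativity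
    at [v] passes to every smaller [u]. *)
Lemma bernstein_pred_sign n l h u v : (l < h)%N -> 0 < u -> u <= v -> v < 1 ->
  0 <= (bernstein_pred n l - bernstein_pred n h).[v] ->
  0 <= (bernstein_pred n l - bernstein_pred n h).[u].
Proof.
case: h => // h; rewrite ltnS => lh u0 uv v1.
have v0 : 0 < v by exact: lt_le_trans uv.
have u1 : u < 1 by exact: le_lt_trans v1.
(* From here [h] stands for the former [h - 1]. If it exceeds [n], the subtracted term vanishes and
   the other one is nonnegative. *)
have [nh|hn] := ltnP n h.
  rewrite /= [bernstein n h]/bernstein bin_small// mulr0n !subr0 => _.
  case: l lh => [|l] _ /=; first by rewrite hornerE.
  by rewrite bernstein_ge0// !ltW.
(* For [l = 0] only the subtracted term remains; it is positive at [v], against the assumption. *)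
case: l lh => [_|l lh] /=.
  rewrite sub0r !hornerN oppr_ge0 hornerbernstein leNgt pmulrn_lgt0 ?bin_gt0//.
  by rewrite mulr_gt0// exprn_gt0// subr_gt0.
have hE : (h = l + (h - l))%N by rewrite subnKC// ltnW.
have lE : (n - l = (h - l) + (n - h))%N by rewrite addnC addnBA ?subnK// ltnW.
have factor x : (bernstein n l - bernstein n h).[x] =
    x ^+ l * (1 - x) ^+ (n - h) *
    ((1 - x) ^+ (h - l) *+ 'C(n, l) - x ^+ (h - l) *+ 'C(n, h)).
  rewrite hornerD hornerN !hornerbernstein lE exprD.
  have -> : x ^+ h = x ^+ l * x ^+ (h - l) by rewrite -exprD -hE.
  rewrite mulrBr !mulrnAr.
  by congr (_ *+ _ - _ *+ _); [rewrite mulrA mulrAC|rewrite mulrAC].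
have w0 x : 0 < x -> x < 1 -> 0 < x ^+ l * (1 - x) ^+ (n - h).
  by move=> x0 x1; rewrite mulr_gt0// exprn_gt0// subr_gt0.
(* With the weight removed, moving from [v] down to [u] lowers the power of x and raises the power
   of 1 - x. *)
rewrite !factor !pmulr_rge0 ?w0// !subr_ge0 => vle.
apply: le_trans (le_trans vle _); first by
  rewrite lerMn2r lerXn2r ?orbT// nnegrE ltW.
by rewrite lerMn2r lerXn2r ?orbT ?nnegrE ?subr_ge0 ?lerD2l ?lerN2// ltW.
Qed.

(** The hypothesis lets the derivative change sign at most once on (0, 1), from plus to minus. If it
    is nonnegative at [y], then [p] increases up to [y] and [p.[x]] is the lower bound; otherwise
    [p] decreases after [y] and [p.[z]] is. *)
Lemma poly_quasi_concave (p : {poly R}) :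
  (forall u v, 0 < u -> u <= v -> v < 1 -> 0 <= p^`().[v] -> 0 <= p^`().[u]) ->
  forall x y z, 0 <= x -> x <= y -> y <= z -> z <= 1 ->
  Num.min p.[x] p.[z] <= p.[y].
Proof.
move=> signp x y z x0 xy yz z1.
move: (xy); rewrite le_eqVlt => /predU1P[<-|xy']; first by rewrite ge_min lexx.
move: (yz); rewrite le_eqVlt => /predU1P[->|yz'].
  by rewrite ge_min lexx orbT.
have cp (a b : R) : {within `[a, b], continuous (horner p)}.
  exact/continuous_subspaceT/continuous_horner.
have dp (a b c : R) : c \in `]a, b[ -> derivable (horner p) c 1.
  by move=> _; exact: derivable_horner.
rewrite ge_min; have [p0|p0] := leP 0 p^`().[y].
  apply/orP; left.
  apply: (@ger0_derive1_le_cc _ (horner p) x y (@dp _ _)) => //;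
    rewrite ?in_itv/= ?lexx ?xy//.
  move=> c; rewrite in_itv/= => /andP[xc cy]; rewrite -derivE.
  apply: (signp c y) => //; [exact: le_lt_trans xc|exact: ltW|].
  exact: lt_le_trans z1.
apply/orP; right.
apply: (@ler0_derive1_le_cc _ (horner p) y z (@dp _ _)) => //;
  rewrite ?in_itv/= ?lexx ?yz ?andbT//.
move=> c; rewrite in_itv/= => /andP[yc cz]; rewrite -derivE.
rewrite leNgt; apply/negP => c0; move: p0; rewrite ltNge => /negP; apply.
apply: (signp y c) => //; [exact: le_lt_trans xy'|exact: ltW| |exact: ltW].
exact: lt_le_trans z1.
Qed.

Lemma sum_bernstein_quasi_concave n l h x y z : (l < h)%N ->
  0 <= x -> x <= y -> y <= z -> z <= 1 ->
  let p := \sum_(l <= k < h) bernstein n.+1 k in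
  Num.min p.[x] p.[z] <= p.[y].
Proof.
move=> lh x0 xy yz z1; cbv zeta; apply: poly_quasi_concave => // u v u0 uv v1.
rewrite deriv_sum_bernstein; last exact: ltnW.
rewrite !hornerMn !pmulrn_lge0//; exact: bernstein_pred_sign.
Qed.

Lemma sum_bernstein_itv01 n l h x : (l <= h)%N -> (h <= n.+1)%N ->
  0 <= x <= 1 -> 0 <= (\sum_(l <= k < h) bernstein n k).[x] <= 1.
Proof.
move=> lh hn x01; rewrite horner_sum sumr_ge0/=; last first.
  by move=> k _; exact: bernstein_ge0.
rewrite (_ : 1 = (\sum_(0 <= k < n.+1) bernstein n k).[x]); last first.
  by rewrite sum_bernstein hornerE.
rewrite horner_sum [leRHS](@big_cat_nat _ _ _ l)//=; last exact: leq_trans hn.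
rewrite [X in _ + X](@big_cat_nat _ _ _ h)//= addrCA lerDl.
by rewrite addr_ge0// sumr_ge0// => k _; exact: bernstein_ge0.
Qed.

(** The integral of x^k (1-x)^(n-k) over [0, 1] is the beta value k! (n-k)! / (n+1)!. The cutoff
    outside [0, 1] keeps the integrand nonnegative on the whole line. *)
Lemma integral_bernstein n k : (k <= n)%N ->
  (\int[uniform_prob (@ltr01 R)]_x
     ((fun x => if 0 <= x <= 1 then (bernstein n k).[x] else 0) x)%:E =
   (n.+1%:R^-1)%:E)%E.
Proof.
move=> kn; rewrite integral_uniform; last 2 first.
- apply/measurable_EFinP; apply: measurable_fun_if => //.
  + by apply: measurable_and => //; exact: measurable_fun_ler.
  + by apply: measurable_funTS; apply: continuous_measurable_fun;
      exact: continuous_horner.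
- move=> x; rewrite lee_fin; case: ifPn => // x01; exact: bernstein_ge0.
rewrite subr0 invr1 mul1e.
transitivity ((beta_fun k.+1 (n - k).+1 *+ 'C(n, k) : R)%:E).
  rewrite -mulr_natl EFinM EFin_beta_fun -ge0_integralZl//=; first last.
  - move=> x _; rewrite lee_fin patchE; case: ifPn => // /set_mem.
    exact: XMonemX_ge0.
  - apply/measurable_EFinP/measurable_restrict => //.
    exact: measurable_XMonemX.
  rewrite [LHS]integral_mkcond; apply: eq_integral => x _.
  rewrite !patchE; case: ifPn => x01; last by rewrite mule0.
  move: x01; rewrite inE/= in_itv/= => ->.
  by rewrite hornerbernstein -EFinM mulr_natl.
rewrite beta_fun_fact subnKC// factS -mulrnAl.
rewrite -mulrnA mulnC bin_fact// natrM; congr (_%:E).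
by rewrite invfM mulrCA divff ?mulr1// pnatr_eq0 -lt0n fact_gt0.
Qed.

End bernstein.

(** * Conditionally binomial counts *)

(** Grouping by cardinality: there are ['C(n, k)] subsets of size [k]. *)
Lemma sum_card_draws (V : nmodType) n l h (f : nat -> V) :
  \sum_(s : {set 'I_n} | (l <= #|s| < h)%N) f #|s| =
  \sum_(l <= k < h) f k *+ 'C(n, k).
Proof.
transitivity (\sum_(l <= k < h) \sum_(s : {set 'I_n} | k == #|s|) f #|s|).
  rewrite (exchange_big_dep predT)//= [LHS]big_mkcond; apply: eq_bigr => s _.
  by rewrite big_nat1_eq.
apply: eq_bigr => k _; rewrite (eq_bigr (fun=> f k)) => [|s /eqP<-//].
rewrite sumr_const -[in RHS](card_ord n) -card_draws; congr (_ *+ _).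
by apply: eq_card => s; rewrite !inE eq_sym.
Qed.

(** * Laws of random tuples and disintegration *)

Lemma measurable_box d (T : measurableType d) n (A : 'I_n -> set T) :
  (forall i, measurable (A i)) ->
  measurable [set t : n.-tuple T | forall i, A i (tnth t i)].
Proof.
move=> mA.
rewrite (_ : mkset _ = \bigcap_(i in [set: 'I_n]) ((@tnth n T)^~ i @^-1` A i));
  last by apply/seteqP; split => [t At i _|t At i]; exact: At.
apply: fin_bigcap_measurable; first exact: finite_finset.
by move=> i _; rewrite -[X in measurable X]setTI; exact: measurable_tnth.
Qed.

(** Boxes are stable under intersection, include the whole space and generate the product
    sigma-algebra, so they determine a finite measure. *)
Lemma tuple_measure_unique d (T : measurableType d) (R : realType) n
    (m1 m2 : {finite_measure set (n.-tuple T) -> \bar R}) :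
  (forall A : 'I_n -> set T, (forall i, measurable (A i)) ->
    m1 [set t | forall i, A i (tnth t i)] =
    m2 [set t | forall i, A i (tnth t i)]) ->
  forall X, measurable X -> m1 X = m2 X.
Proof.
move=> m12.
pose G : set (set (n.-tuple T)) := [set X | exists2 A : 'I_n -> set T,
  (forall i, measurable (A i)) & X = [set t | forall i, A i (tnth t i)]].
have GT : G setT by exists (fun=> setT) => //; apply/seteqP; split.
apply: (measure_unique G (fun=> setT)) => //.
- apply/seteqP; split => [X mX|]; last first.
    apply: smallest_sub; first exact: sigma_algebra_measurable.
    by move=> _ [A mA ->]; exact: measurable_box.
  (* Boxes generate because the coordinates are measurable for them: the preimage of [Y] under one
     coordinate is a box whose other sides are [setT]. *)
  have : measurable_fun [set: g_sigma_algebraType G]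
      (id : g_sigma_algebraType G -> n.-tuple T).
    apply/measurable_fun_tnthP => i _ Y mY; rewrite setTI.
    apply: sub_sigma_algebra.
    exists (fun j => if j == i then Y else setT) => [j|]; first by case: ifP.
    apply/seteqP; split => [t /= Yt j|t /(_ i)]; last by rewrite eqxx.
    by case: eqP => // ->.
  by move=> /(_ measurableT X mX); rewrite setTI.
- move=> _ _ [A mA ->] [A' mA' ->].
  exists (fun i => A i `&` A' i) => [i|]; first exact: measurableI.
  apply/seteqP; split => [t [At A't] i|t tAA']; first by split.
  by split => i; have [] := tAA' i.
- by rewrite bigcup_const//; exists 0%N.
- by move=> _ [A mA ->]; exact: m12.
- by move=> _; rewrite ltey_eq fin_num_measure.
Qed.

Lemma identically_distributed_tuple d d' (Omega : measurableType d)
    (T : measurableType d') (R : realType) (P : probability Omega R) n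
    (X Y : 'I_n -> Omega -> T)
    (mX : measurable_fun setT (fun w => [tuple X i w | i < n]))
    (mY : measurable_fun setT (fun w => [tuple Y i w | i < n])) :
  mutually_independent P X -> mutually_independent P Y ->
  (forall i, identically_distributed P (X i) (Y i)) ->
  identically_distributed P
    (fun w => [tuple X i w | i < n]) (fun w => [tuple Y i w | i < n]).
Proof.
move=> indX indY XY.
pose Xm : {mfun Omega >-> n.-tuple T} :=
  HB.pack (fun w => [tuple X i w | i < n]) (isMeasurableFun.Build _ _ _ _ _ mX).
pose Ym : {mfun Omega >-> n.-tuple T} :=
  HB.pack (fun w => [tuple Y i w | i < n]) (isMeasurableFun.Build _ _ _ _ _ mY).
apply: (@tuple_measure_unique _ _ _ _ (distribution P Xm) (distribution P Ym)).
move=> A mA; rewrite /distribution /pushforward.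
transitivity (\prod_(i < n) P (X i @^-1` A i))%E.
  rewrite -indX//; congr (P _).
  by apply/seteqP; split => w /= Aw i; have := Aw i; rewrite tnth_mktuple.
under eq_bigr do rewrite XY//.
rewrite -indY//; congr (P _).
by apply/seteqP; split => w /= Aw i; have := Aw i; rewrite tnth_mktuple.
Qed.

Section disintegration.
Context d d1 d2 (Omega : measurableType d) (S : measurableType d1)
  (T : measurableType d2) (R : realType) (P : probability Omega R).
Variables (D : {mfun Omega >-> S}) (X : {mfun Omega >-> T}).

Lemma measurable_preimage_xsection (E : set (S * T)) z : measurable E ->
  measurable (X @^-1` xsection E z).
Proof.
move=> mE; rewrite -[X in measurable X]setTI.
by apply: measurable_funP => //; exact: measurable_xsection.
Qed.

Lemma measurable_prob_xsection (E : set (S * T)) : measurable E ->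
  measurable_fun setT (fun z => P (X @^-1` xsection E z)).
Proof. exact: (measurable_fun_xsection (distribution P X)). Qed.

(** By independence the law of [(D, X)] is the product of the two laws, and a product measure
    integrates the measures of sections. *)
Lemma independent_disintegration (E : set (S * T)) :
  independent P X D -> measurable E ->
  P [set w | E (D w, X w)] = (\int[P]_w P (X @^-1` xsection E (D w)))%E.
Proof.
move=> XD mE.
have mDX : measurable_fun setT (fun w => (D w, X w)).
  exact: measurable_fun_pair.
pose DX : {mfun Omega >-> (S * T)%type} :=
  HB.pack (fun w => (D w, X w)) (isMeasurableFun.Build _ _ _ _ _ mDX).
rewrite -[LHS]/(distribution P DX E).
rewrite -(@product_measure_unique _ _ _ _ _ (distribution P D)
  (distribution P X)) //.
  rewrite /product_measure1 ge0_integral_distribution//.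
  exact: measurable_prob_xsection.
by move=> A B mA mB; rewrite [RHS]muleC -XD// setIC.
Qed.

End disintegration.

Section binomial_count.
Context d d1 d2 (Omega : measurableType d) (S : measurableType d1)
  (T : measurableType d2) (R : realType) (P : probability Omega R) (B : nat).
Variables (D : {mfun Omega >-> S}) (X : 'I_B -> {mfun Omega >-> T}) (b0 : 'I_B).
Hypothesis indX : mutually_independent P X.
Hypothesis idX : forall b b', identically_distributed P (X b) (X b').
Hypothesis indXD : independent P (fun w => [tuple X b w | b < B]) D.
Variable E : set (S * T).
Hypothesis mE : measurable E.

(** The probability that one replicate succeeds when the data equal [z]. The replicates are
    identically distributed, so the choice of [b0] does not matter. *)
Definition section_prob (z : S) : R := fine (P (X b0 @^-1` xsection E z)).

Lemma EFin_section_prob b z :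
  (section_prob z)%:E = P (X b @^-1` xsection E z).
Proof.
rewrite fineK ?fin_num_measure//; last exact: measurable_preimage_xsection.
by apply: idX; exact: measurable_xsection.
Qed.

Lemma measurable_section_prob : measurable_fun setT section_prob.
Proof.
by apply: measurableT_comp => //; exact: measurable_prob_xsection.
Qed.

Lemma section_prob_itv01 z : 0 <= section_prob z <= 1.
Proof.
rewrite -!lee_fin (EFin_section_prob b0) measure_ge0 probability_le1//.
exact: measurable_preimage_xsection.
Qed.

Lemma independent_coord b : independent P (X b) D.
Proof.
move=> A1 A2 mA1 mA2.
have mA1' : measurable [set t : B.-tuple T | A1 (tnth t b)].
  by rewrite -[X in measurable X]setTI; exact: measurable_tnth.
have := indXD mA1' mA2; rewrite /preimage/=.
by under eq_set do rewrite tnth_mktuple.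
Qed.

(** Disintegration of [E] restricted to data in [A]: the section is that of [E] when the data lie in
    [A] and empty otherwise. *)
Lemma section_prob_version b A : measurable A ->
  P ([set w | E (D w, X b w)] `&` D @^-1` A) =
  (\int[P]_(w in D @^-1` A) (section_prob (D w))%:E)%E.
Proof.
move=> mA.
transitivity (P [set w | (E `&` (A `*` setT)) (D w, X b w)]).
  by congr (P _); apply/seteqP; split => w /=; tauto.
rewrite independent_disintegration; last 2 first.
- exact: independent_coord.
- by apply: measurableI => //; exact: measurableX.
rewrite [RHS]integral_mkcond; apply: eq_integral => w _.
rewrite patchE; case: ifPn => [/set_mem DA|/negP DA].
  rewrite (EFin_section_prob b); congr (P _).
  apply/seteqP; split => v /=; rewrite /xsection/= !inE; first by case.
  by split.
rewrite [X in P X](_ : _ = set0) ?measure0//.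
apply/seteqP; split => v //=; rewrite /xsection/= inE => -[_ [/= AD _]].
by apply: DA; rewrite inE.
Qed.

Let success w := [set b | (D w, X b w) \in E]%SET.

Let pattern (s : {set 'I_B}) : set Omega := [set w | success w = s].

Lemma measurable_pattern s : measurable (pattern s).
Proof.
rewrite (_ : pattern s = \bigcap_(b in [set: 'I_B])
   (if b \in s then [set w | E (D w, X b w)] else ~` [set w | E (D w, X b w)])).
  apply: fin_bigcap_measurable; first exact: finite_finset.
  move=> b _.
  have mb : measurable [set w | E (D w, X b w)].
    have mDX : measurable_fun setT (fun w => (D w, X b w)).
      exact: measurable_fun_pair.
    by rewrite -[X in measurable X]setTI; exact: mDX.
  by case: ifP => // _; exact: measurableC.
apply/seteqP; split => [w ws b _|w ws].
  rewrite -ws inE; case: ifPn => /=; first by rewrite inE.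
  by rewrite notin_setE.
apply/setP => b; rewrite inE; have := ws b I.
case: ifP => /= _; first exact: mem_set.
exact: memNset.
Qed.

(** For fixed data the replicates succeed independently with the same probability, so a given
    success set has a product probability; disintegration averages it over the data. *)
Lemma prob_pattern s : P (pattern s) =
  (\int[P]_w (section_prob (D w) ^+ #|s| *
             (1 - section_prob (D w)) ^+ (B - #|s|))%:E)%E.
Proof.
pose Xall w := [tuple X b w | b < B].
have mXall : measurable_fun setT Xall.
  apply/measurable_fun_tnthP => b; rewrite (_ : _ \o _ = X b)//.
  by apply/funext => w /=; rewrite tnth_mktuple.
pose Xm : {mfun Omega >-> B.-tuple T} :=
  HB.pack Xall (isMeasurableFun.Build _ _ _ _ _ mXall).
(* One constraint per replicate, success or failure: the section at fixed data is then a box, to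
   which independence applies. *)
pose side (b : 'I_B) : set (S * T) := if b \in s then E else ~` E.
have mside b : measurable (side b).
  by rewrite /side; case: ifP => // _; exact: measurableC.
pose Es : set (S * B.-tuple T) := [set u | forall b, side b (u.1, tnth u.2 b)].
have mEs : measurable Es.
  rewrite (_ : Es = \bigcap_(b in [set: 'I_B])
      ((fun u => (u.1, tnth u.2 b)) @^-1` side b)); last first.
    by apply/seteqP; split => [t At i _|t At i]; exact: At.
  apply: fin_bigcap_measurable; first exact: finite_finset.
  move=> b _; rewrite -[X in measurable X]setTI.
  suff : measurable_fun setT
    (fun u : S * B.-tuple T => (u.1, tnth u.2 b)) by exact.
  apply: measurable_fun_pair => //.
  by apply: (measurableT_comp (measurable_tnth b)).
transitivity (P [set w | Es (D w, Xm w)]).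
  congr (P _); apply/seteqP; split => [w ws b|w ws] /=.
    rewrite tnth_mktuple /side -(ws : success w = s) inE.
    by case: ifPn => /=; [rewrite inE|rewrite notin_setE].
  apply/setP => b; rewrite inE; have := ws b; rewrite /side /= tnth_mktuple.
  by case: ifP => /= _; [exact: mem_set|exact: memNset].
rewrite independent_disintegration//; apply: eq_integral => w _.
transitivity (P [set v | forall b, xsection (side b) (D w) (X b v)]).
  congr (P _); apply/seteqP; split => v /=; rewrite /xsection /= inE => sv b.
    by rewrite inE; have := sv b; rewrite /= tnth_mktuple.
  by have := sv b; rewrite /= tnth_mktuple inE.
transitivity (\prod_(b < B) P (X b @^-1` xsection (side b) (D w)))%E.
  apply: (@indX (fun b => xsection (side b) (D w))) => b.
  exact: measurable_xsection.
rewrite (bigID (mem s)) /= EFinM; congr (_ * _)%E.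
  rewrite -prodr_const -prodEFin; apply: eq_bigr => b bs.
  by rewrite /side bs (EFin_section_prob b).
rewrite (_ : (B - #|s|)%N = #|~: s|%SET); last first.
  by rewrite -[X in (X - _)%N](card_ord B) -(cardsC s) addKn.
rewrite -prodr_const -prodEFin.
apply: eq_big => [b|b bs]; first by rewrite inE.
rewrite /side (negbTE bs) EFinB (EFin_section_prob b).
rewrite -probability_setC; last exact: measurable_preimage_xsection.
congr (P _); apply/seteqP; split => v /=; rewrite /xsection /= !inE//.
Qed.

(** The event is the disjoint union of the patterns whose size lies in the window; grouping them by
    size gives the Bernstein sum. *)
Lemma prob_success_count l h :
  P [set w | (l <= #|[set b | (D w, X b w) \in E]%SET| < h)%N] =
  (\int[P]_w ((\sum_(l <= k < h) bernstein R B k).[section_prob (D w)])%:E)%E.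
Proof.

pose r := enum [pred s : {set 'I_B} | (l <= #|s| < h)%N].
rewrite (_ : mkset _ = \bigcup_(s in [set` r]) pattern s); last first.
  apply/seteqP; split => [w ws|w [s /= + ws]]; last first.
    by rewrite mem_enum -(ws : success w = s).
  by exists (success w) => //=; rewrite mem_enum.
rewrite measure_fin_bigcup//; last 2 first.
- by move=> s s' _ _ [w [ws ws']]; rewrite -(ws : success w = s).
- by move=> s _; exact: measurable_pattern.
rewrite -fsbig_seq ?enum_uniq//=.
under eq_bigr do rewrite prob_pattern.
have mp : measurable_fun setT (section_prob \o D).
  by apply: measurableT_comp => //; exact: measurable_section_prob.
rewrite -ge0_integral_sum//; last 2 first.
- move=> s; apply/measurable_EFinP; apply: measurable_funM.
    exact: measurable_funX.
  by apply: measurable_funX; exact: measurable_funB.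
- move=> s w _; have /andP[p0 p1] := section_prob_itv01 (D w).
  by rewrite lee_fin mulr_ge0// exprn_ge0// subr_ge0.
apply: eq_integral => w _; rewrite sumEFin big_enum/=; congr (_%:E).
rewrite horner_sum; under [RHS]eq_bigr do rewrite hornerbernstein.
apply: etrans (sum_card_draws B l h (fun k => section_prob (D w) ^+ k *
  (1 - section_prob (D w)) ^+ (B - k))).
by apply: eq_bigl => s; rewrite inE.
Qed.

End binomial_count.

(** * Kolmogorov-Smirnov distance *)

Section kolmogorov_smirnov.
Variable R : realType.
Implicit Types (mu nu : probability R R) (a b c t : R).

(** The supremum is a genuine upper bound because differences of probabilities are bounded by 1. *)
Lemma prob_itv_le_ks_dist mu nu a b :
  `|fine (mu `]a, b]%classic) - fine (nu `]a, b]%classic)| <= ks_dist mu nu.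
Proof.
apply: ub_le_sup; last by exists a, b.
exists 1 => _ [s [t ->]].
have fine01 (m : probability R R) : 0 <= fine (m `]s, t]%classic) <= 1.
  rewrite fine_ge0//= -lee_fin fineK ?fin_num_measure//.
  exact: probability_le1.
have /andP[? ?] := fine01 mu; have /andP[? ?] := fine01 nu.
by rewrite ler_norml; apply/andP; split; lra.
Qed.

Lemma cvg_prob_itvoc mu a b :
  fine (mu `]a - n.+1%:R^-1, b]%classic) @[n --> \oo] -->
  fine (mu `[a, b]%classic).
Proof.
apply: fine_cvg; rewrite fineK ?fin_num_measure//.
have -> : `[a, b]%classic = \bigcap_n `]a - n.+1%:R^-1, b]%classic.
  apply/seteqP; split => [x /= + n _|x xab] /=; rewrite !in_itv/=.
    by move=> /andP[ax ->]; rewrite andbT (lt_le_trans _ ax)// gtrBl invr_gt0.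
  apply/andP; split; last by have := xab 0%N I; rewrite /= in_itv/= => /andP[].
  apply/ler_addgt0Pr => e e0.
  have [n ne] : exists n, n.+1%:R^-1 < e.
    exists (Num.truncn e^-1); rewrite -[ltRHS]invrK ltf_pV2 ?posrE ?invr_gt0//.
    by rewrite truncnS_gt// .
  have := xab n I; rewrite /= in_itv/= => /andP[+ _].
  by rewrite ltrBlDr => /ltW/le_trans; apply; rewrite lerD2l ltW.
apply: nonincreasing_cvg_mu.
- by rewrite ltey_eq fin_num_measure.
- by move=> n; exact: measurable_itv.
- by apply: bigcapT_measurable => n; exact: measurable_itv.
- move=> m n mn; apply/subsetPset => x /=; rewrite !in_itv/= => /andP[+ ->].
  rewrite andbT; apply: le_lt_trans; rewrite lerD2l lerN2 lef_pV2 ?posrE//.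
  by rewrite ler_nat.
Qed.

(** Superlevel sets are closed intervals while the distance uses half-open ones; the bound passes to
    the limit along []a - n.+1%:R^-1, b]], which decreases to [[a, b]]. *)
Lemma prob_itvcc_le_ks_dist mu nu a b :
  `|fine (mu `[a, b]%classic) - fine (nu `[a, b]%classic)| <= ks_dist mu nu.
Proof.
have h : `|fine (mu `]a - n.+1%:R^-1, b]%classic) -
           fine (nu `]a - n.+1%:R^-1, b]%classic)| @[n --> \oo] -->
    `|fine (mu `[a, b]%classic) - fine (nu `[a, b]%classic)|.
  by apply: cvg_norm; apply: cvgB; exact: cvg_prob_itvoc.
apply: (cvgr_to_le h).
by apply: nearW => n; exact: prob_itv_le_ks_dist.
Qed.

(** The set is compact, so it contains its least and greatest points, and quasi-concavity fills the
    gap between them. *)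
Lemma superlevel_itv (p : {poly R}) t :
  (forall x y z : R, 0 <= x -> x <= y -> y <= z -> z <= 1 ->
    Num.min p.[x] p.[z] <= p.[y]) ->
  exists a b : R, [set x : R | 0 <= x <= 1 /\ t <= p.[x]] = `[a, b]%classic.
Proof.
move=> qp; set X := mkset _.
have [->|/set0P X0] := eqVneq X set0.
  (* The empty set is the reversed interval [[1, 0]]. *)
  exists 1, 0; apply/esym/seteqP; split => // x /=; rewrite in_itv/=.
  by move=> /andP[x1 x0]; have := le_trans x1 x0; rewrite ler10.
have cX : compact X.
  have -> : X = `[0, 1]%classic `&` horner p @^-1` [set y | t <= y].
    by apply/seteqP; split => x /=; rewrite in_itv.
  apply: compact_closedI; first exact: segment_compact.
  apply: preimage_closed; last exact: closed_ge.
  by move=> x _; exact: continuous_horner.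
have cid : {within X, continuous (@idfun R)}.
  by apply/continuous_subspaceT => x; exact: cvg_id.
have [a /set_mem[a01 ta] amin] := compact_EVT_min X0 cX cid.
have [b /set_mem[b01 tb] bmax] := compact_EVT_max X0 cX cid.
exists a, b; apply/seteqP; split => x /= => [Xx|].
  by rewrite in_itv/= amin ?bmax// inE.
rewrite in_itv/= => /andP[ax xb].
move: a01 b01 => /andP[a0 a1] /andP[b0 b1].
split; first by rewrite (le_trans a0 ax) (le_trans xb b1).
by apply: le_trans (qp a x b a0 ax xb b1); rewrite le_min ta tb.
Qed.

(** The expectation is the integral of the tail probabilities. As [g <= 1], only levels in [0, 1]
    contribute, and the error [e] is integrated over length 1. *)
Lemma layer_cake_le mu nu (g : {mfun R >-> R}) (e : R) : 0 <= e ->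
  (forall x, 0 <= g x <= 1) ->
  (forall r, (mu (g @^-1` `]r, +oo[) <= nu (g @^-1` `]r, +oo[) + e%:E)%E) ->
  (\int[mu]_x (g x)%:E <= \int[nu]_x (g x)%:E + e%:E)%E.
Proof.
move=> e0 g01 munu.
have tail (m : probability R R) : (\int[m]_x (g x)%:E =
    \int[lebesgue_measure]_(r in `[0%R, 1%R]) m (g @^-1` `]r, +oo[))%E.
  pose G : {RV m >-> R} := g.
  have := @ge0_expectation_ccdf _ _ _ m G (fun x => (andP (g01 x)).1).
  rewrite expectation_def => ->.
  rewrite [LHS]integral_mkcond [RHS]integral_mkcond.
  apply: eq_integral => r _; rewrite !patchE !mem_setE !in_itv/= andbT.
  case: leP => //= r0; case: leP => // r1.
  rewrite /ccdf /distribution /pushforward (_ : _ @^-1` _ = set0) ?measure0//.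
  apply/seteqP; split => // x /=; rewrite in_itv/= andbT => rx.
  by have /andP[_] := g01 x; rewrite leNgt (lt_trans r1 rx).
have mtail (m : probability R R) : measurable_fun (`[0, 1]%classic : set R)
    (fun r : R => m (g @^-1` `]r, +oo[)).
  by apply: measurable_funTS; exact: (@ccdf_measurable _ _ _ m g).
rewrite !tail.
have -> : e%:E = (\int[lebesgue_measure]_(r in `[0%R, 1%R]) (cst e%:E r))%E.
  by rewrite integral_cst//= lebesgue_measure_itv/= lte_fin ltr01 sube0 mule1.
rewrite -ge0_integralD//; last exact: mtail.
apply: ge0_le_integral => //; first exact: mtail.
by apply: emeasurable_funD => //; exact: mtail.
Qed.

Lemma integral_le1_fin_num mu (f : R -> R) : measurable_fun setT f ->
  (forall x, 0 <= f x <= 1) -> (\int[mu]_x (f x)%:E)%E \is a fin_num.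
Proof.
move=> mf f01.
rewrite ge0_fin_numE; last first.
  by apply: integral_ge0 => x _; rewrite lee_fin; case/andP: (f01 x).
apply: le_lt_trans (ltry 1).
apply: (@le_trans _ _ (\int[mu]_x (cst 1%:E x)))%E.
  apply: ge0_le_integral => //.
  - by move=> x _; rewrite lee_fin; case/andP: (f01 x).
  - exact/measurable_EFinP.
  - by move=> x _; rewrite lee_fin; case/andP: (f01 x).
by rewrite integral_cst//= probability_setT mule1.
Qed.

Lemma ge0_integral_1B mu (f : R -> R) : measurable_fun setT f ->
  (forall x, 0 <= f x <= 1) ->
  (\int[mu]_x (1 - f x)%:E = 1 - \int[mu]_x (f x)%:E)%E.
Proof.
move=> mf f01.
have : (\int[mu]_x (1 - f x)%:E + \int[mu]_x (f x)%:E = 1)%E.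
  rewrite -ge0_integralD//.
  - under eq_integral do rewrite -EFinD subrK.
    by rewrite integral_cst//= probability_setT mule1.
  - by move=> x _; rewrite lee_fin subr_ge0; case/andP: (f01 x).
  - exact/measurable_EFinP/measurable_funB.
  - by move=> x _; rewrite lee_fin; case/andP: (f01 x).
  - exact/measurable_EFinP.
by move=> <-; rewrite addeK// integral_le1_fin_num.
Qed.

Lemma layer_cake_dist mu nu (f : R -> R) (e : R) : measurable_fun setT f ->
  (forall x, 0 <= f x <= 1) ->
  (forall t,
    `|fine (mu [set x | t <= f x]) - fine (nu [set x | t <= f x])| <= e) ->
  `|fine (\int[mu]_x (f x)%:E)%E - fine (\int[nu]_x (f x)%:E)%E| <= e.
Proof.
move=> mf f01 fe.
(* The strict superlevel sets of [1 - f], which the tail formula involves, are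
   the complements of the sets [t <= f]. *)
have e0 : 0 <= e by exact: le_trans (fe 0).
have mg : measurable_fun setT (fun x => 1 - f x) by exact: measurable_funB.
pose g : {mfun R >-> R} := HB.pack (fun x => 1 - f x)
  (isMeasurableFun.Build _ _ _ _ _ mg).
have g01 x : 0 <= g x <= 1.
  by have /andP[? ?] := f01 x; rewrite /g/=; apply/andP; split; lra.
have mle t : measurable [set x | t <= f x].
  rewrite -[X in measurable X]setTI.
  rewrite (_ : [set x | t <= f x] = f @^-1` `[t, +oo[%classic); last first.
    by apply/seteqP; split => x /=; rewrite in_itv/= andbT.
  exact: mf.
have tailE (m : probability R R) r :
    (m (g @^-1` `]r, +oo[) = (1 - fine (m [set x | 1 - r <= f x]))%:E)%E.
  rewrite EFinB fineK ?fin_num_measure// -probability_setC//; congr (m _).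
  apply/seteqP; split => x /=; rewrite in_itv/= andbT /g/= => h; first by
    apply/negP; rewrite -ltNge; lra.
  by move/negP: h; rewrite -ltNge => h; lra.
(* Returning from [1 - f] to [f] exchanges the two measures; the two orders together give the
   absolute value. *)
have one_side (m1 m2 : probability R R) :
    (forall t,
      `|fine (m1 [set x | t <= f x]) - fine (m2 [set x | t <= f x])| <= e) ->
    fine (\int[m2]_x (f x)%:E)%E <= fine (\int[m1]_x (f x)%:E)%E + e.
  move=> h; have : (\int[m1]_x (g x)%:E <= \int[m2]_x (g x)%:E + e%:E)%E.
    apply: layer_cake_le => // r; rewrite !tailE -EFinD lee_fin.
    by have := h (1 - r); rewrite ler_norml => /andP[? ?]; lra.
  rewrite /g/= !ge0_integral_1B//.
  have h1 := integral_le1_fin_num m1 mf f01.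
  have h2 := integral_le1_fin_num m2 mf f01.
  rewrite -(fineK h1) -(fineK h2) -!EFinB -EFinD lee_fin !fineK//; lra.
rewrite ler_norml; apply/andP; split.
  have := one_side mu nu fe; lra.
have : fine (\int[mu]_x (f x)%:E)%E <= fine (\int[nu]_x (f x)%:E)%E + e.
  by apply: one_side => t; rewrite distrC.
lra.
Qed.

(** The conditional coverage as a function of the success probability, extended by 0 so that it is
    defined and lies in [0, 1] on the whole line. *)
Definition bernstein_win (n l h : nat) (x : R) : R :=
  if 0 <= x <= 1 then (\sum_(l <= k < h) bernstein R n k).[x] else 0.

Lemma measurable_bernstein_win n l h :
  measurable_fun setT (bernstein_win n l h).
Proof.
apply: measurable_fun_if => //.
  by apply: measurable_and => //; exact: measurable_fun_ler.
by apply: measurable_funTS; apply: continuous_measurable_fun;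
  exact: continuous_horner.
Qed.

Lemma bernstein_win_itv01 n l h x : (l <= h)%N -> (h <= n.+1)%N ->
  0 <= bernstein_win n l h x <= 1.
Proof.
move=> lh hn; rewrite /bernstein_win; case: ifPn => [x01|_].
  exact: sum_bernstein_itv01.
by rewrite lexx ler01.
Qed.

Lemma integral_bernstein_win n l h : (l <= h)%N -> (h <= n.+1)%N ->
  (\int[uniform_prob (@ltr01 R)]_x (bernstein_win n l h x)%:E =
   ((h - l)%:R / n.+1%:R)%:E)%E.
Proof.
move=> lh hn.
transitivity (\sum_(l <= k < h) \int[uniform_prob (@ltr01 R)]_x
    ((fun x : R => if 0 <= x <= 1 then (bernstein R n k).[x] else 0) x)%:E)%E.
  rewrite -ge0_integral_sum//.
  - apply: eq_integral => x _; rewrite /bernstein_win; case: ifPn => x01.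
      by rewrite horner_sum -sumEFin.
    by rewrite big1.
  - move=> k; apply/measurable_EFinP; apply: measurable_fun_if => //.
      by apply: measurable_and => //; exact: measurable_fun_ler.
    by apply: measurable_funTS; apply: continuous_measurable_fun;
      exact: continuous_horner.
  - move=> k x _; rewrite lee_fin; case: ifPn => // x01; exact: bernstein_ge0.
rewrite (@eq_big_nat _ _ _ _ _ _ (fun=> (n.+1%:R^-1)%:E)); last first.
  move=> k /andP[_ kh]; apply: integral_bernstein.
  by rewrite -ltnS (leq_trans kh).
rewrite sumEFin; congr (_%:E).
by rewrite big_const_nat iter_addr_0 mulr_natl.
Qed.

(** A positive level excludes the points outside [0, 1], where the function is 0. *)
Lemma superlevel_bernstein_win n l h t : (l < h)%N -> 0 < t ->
  exists a b, [set x | t <= bernstein_win n.+1 l h x] = `[a, b]%classic.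
Proof.
move=> lh t0.
have [a [b abE]] := @superlevel_itv (\sum_(l <= k < h) bernstein R n.+1 k) t
  (fun x y z => @sum_bernstein_quasi_concave R n l h x y z lh).
exists a, b; rewrite -abE; apply/seteqP; split => x /=; rewrite /bernstein_win.
  by case: ifPn => // _; rewrite leNgt t0.
by case=> ->.
Qed.

Lemma bernstein_win_ks_dist mu n l h : (l < h)%N -> (h <= n.+2)%N ->
  `|fine (\int[mu]_x (bernstein_win n.+1 l h x)%:E)%E - (h - l)%:R / n.+2%:R|
    <= ks_dist mu (uniform_prob (@ltr01 R)).
Proof.
move=> lh hn.
pose win := bernstein_win n.+1 l h.
have mwin : measurable_fun setT win := measurable_bernstein_win _ _ _.
have win01 x : 0 <= win x <= 1 by exact: bernstein_win_itv01 (ltnW lh) hn.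
have mid : measurable_fun setT (idfun : measurableTypeR R -> R).
  by move=> _ Y mY; rewrite setTI preimage_id.
pose ident : {mfun measurableTypeR R >-> R} :=
  HB.pack (idfun : measurableTypeR R -> R)
    (isMeasurableFun.Build _ _ _ _ _ mid).
(* [uniform_prob] lives on [measurableTypeR R], whose display is not that of
   [R]; it is transported to [R] along the identity. *)
pose unif : probability R R := distribution (uniform_prob (@ltr01 R)) ident.
have -> : (h - l)%:R / n.+2%:R = fine (\int[unif]_x (win x)%:E)%E.
  rewrite ge0_integral_distribution//; last 2 first.
  - exact/measurable_EFinP.
  - by move=> x; rewrite lee_fin; case/andP: (win01 x).
  by rewrite -[LHS]/(fine (_%:E)) -integral_bernstein_win// ltnW.
apply: (@layer_cake_dist mu unif win _ mwin win01) => t.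
(* At levels [t <= 0] the superlevel set is everything and both measures give it mass 1. *)
have [t0|t0] := ltP 0 t.
  have [a [b abE]] := superlevel_bernstein_win n lh t0.
  rewrite /win abE; exact: (prob_itvcc_le_ks_dist mu unif).
have -> : [set x | t <= win x] = setT.
  by apply/seteqP; split => // x _ /=; case/andP: (win01 x) => /(le_trans t0).
rewrite !probability_setT subrr normr0.
exact: le_trans (prob_itv_le_ks_dist mu unif 0 0).
Qed.

End kolmogorov_smirnov.

(** * Stochastic gradient descent *)

Lemma eq_sgd (R : realType) p T (grad : 'rV[R]_p -> T -> 'rV[R]_p) init
    (a a' : nat -> R) (z z' : nat -> T) n :
  (forall i, (0 < i <= n)%N -> a i = a' i /\ z i = z' i) ->
  sgd grad init a z n = sgd grad init a' z' n.
Proof.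
elim: n => //= n IHn azE; rewrite IHn => [|i /andP[i0 lin]]; last first.
  by apply: azE; rewrite i0 leqW.
by have [-> ->] := azE n.+1 (ltnSn n.+1).
Qed.

Lemma eq_average (R : realType) p (x x' : nat -> 'rV[R]_p) n :
  (forall i, (0 < i <= n)%N -> x i = x' i) -> average x n = average x' n.
Proof.
by move=> xE; congr (_ *: _); apply: eq_big_nat => i; exact: xE.
Qed.

Section measurable_sgd.
Context d dS (U : measurableType d) (S : measurableType dS) (R : realType).
Variables (p : nat) (grad : 'rV[R]_p -> S -> 'rV[R]_p) (init : 'rV[R]_p).
Hypothesis mgrad : forall k : 'I_p, measurable_fun [set: p.-tuple R * S]
  (fun x => grad (row_of_tuple x.1) x.2 ord0 k).
Variables (a : nat -> U -> R) (z : nat -> U -> S).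
Hypothesis ma : forall n, measurable_fun setT (a n).
Hypothesis mz : forall n, measurable_fun setT (z n).

Let iterate n u := sgd grad init (fun n => a n u) (fun n => z n u) n.

(** Induction for all coordinates at once: the previous iterate enters the gradient as the tuple of
    its coordinates. Steps depending on [u] cover both the plain and the perturbed recursion. *)
Lemma measurable_sgd n k : measurable_fun setT (fun u => iterate n u ord0 k).
Proof.
elim: n k => [|n IHn] k /=; first exact: measurable_cst.
rewrite (_ : (fun u => _) = (fun u => iterate n u ord0 k - a n.+1 u *
  grad (row_of_tuple [tuple iterate n u ord0 i | i < p]) (z n.+1 u) ord0 k)).
  apply: measurable_funB; first exact: IHn.
  apply: measurable_funM => //.
  apply: (measurableT_comp (mgrad k) (g := fun u =>
    ([tuple iterate n u ord0 i | i < p], z n.+1 u))).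
  apply: measurable_fun_pair => //; apply/measurable_fun_tnthP => i.
  rewrite (_ : _ \o _ = fun u => iterate n u ord0 i); first exact: IHn.
  by apply/funext => u /=; rewrite tnth_mktuple.
apply/funext => u; rewrite /iterate /= !mxE; congr (_ - _ * grad _ _ _ _).
by apply/rowP => i; rewrite mxE tnth_mktuple.
Qed.

Lemma measurable_average_sgd n k :
  measurable_fun setT (fun u => average (iterate^~ u) n ord0 k).
Proof.
rewrite (_ : (fun u => _) = (fun u => n%:R^-1 *
    \sum_(i <- index_iota 1 n.+1) iterate i u ord0 k)); last first.
  by apply/funext => u; rewrite /average mxE summxE.
apply: measurable_funM => //; apply: measurable_sum => i; exact: measurable_sgd.
Qed.

End measurable_sgd.

(** * Versions of a conditional probability, and integer ranks *)

Lemma ae_eq_preimage d d' (T : measurableType d) (T' : measurableType d')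
    (R : realType) (mu : {measure set T -> \bar R}) (f g : T -> T') :
  measurable_fun setT f -> measurable_fun setT g -> ae_eq mu setT f g ->
  forall Y, measurable Y -> mu (f @^-1` Y) = mu (g @^-1` Y).
Proof.
move=> mf mg fg Y mY.
have mfY : measurable (f @^-1` Y).
  by rewrite -[X in measurable X]setTI; exact: mf.
have mgY : measurable (g @^-1` Y).
  by rewrite -[X in measurable X]setTI; exact: mg.
have := integral_indic mu measurableT mfY; rewrite setIT => <-.
have := integral_indic mu measurableT mgY; rewrite setIT => <-.
apply: ae_eq_integral => //; try exact/measurable_EFinP/measurable_indic.
apply: filterS fg => x /= fgx _; rewrite !indicE; congr (_%:R%:E).
by congr (nat_of_bool _); apply/idP/idP; rewrite !inE /= fgx.
Qed.

(** By change of variables, two versions have equal integrals over every measurable set under the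
    law of [D]. *)
Lemma cond_prob_version_ae_eq d d' (Omega : measurableType d)
    (T : measurableType d') (R : realType) (P : probability Omega R)
    (D : {mfun Omega >-> T}) (E : set Omega) (F G : T -> R) :
  cond_prob_version P D E F -> cond_prob_version P D E G ->
  ae_eq (distribution P D) setT F G.
Proof.
move=> [mF iF FE] [mG iG GE].
have mD : measurable_fun setT D by [].
have mF' : measurable_fun setT (EFin \o F) by exact/measurable_EFinP.
have mG' : measurable_fun setT (EFin \o G) by exact/measurable_EFinP.
have iD (f : Omega -> \bar R) A : measurable A ->
    P.-integrable setT f -> P.-integrable (D @^-1` A) f.
  move=> mA; apply: integrableS => //.
  by rewrite -[X in measurable X]setTI; exact: mD.
have : ae_eq (distribution P D) setT (EFin \o F) (EFin \o G).
  apply: integral_ae_eq => // [|A _ mA].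
    exact: (integrable_pushforward mD mF' (iD _ _ measurableT iF)).
  rewrite /distribution (integral_pushforward mD mF' (iD _ _ mA iF))//.
  rewrite (integral_pushforward mD mG' (iD _ _ mA iG))//.
  exact: etrans (FE A mA) (esym (GE A mA)).
by apply: filterS => x /= FGx xT; have [] := FGx xT.
Qed.

(** The gap [hi - lo] is the ceiling of a positive number. Also [hi] is below (B+1)(1-alpha) + 1 +
    (B+1)alpha/2, hence below B + 2. *)
Lemma quantile_ranks (R : realType) (B : nat) (alpha : R) :
  0 < alpha -> alpha < 1 ->
  let lo := Num.floor (B.+1%:R * (alpha / 2)) in
  let hi := Num.ceil (B.+1%:R * (1 - alpha)) + lo in
  exists l h : nat, [/\ lo = l, hi = h, (l < h)%N & (h <= B.+1)%N].
Proof.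
move=> a0 a1 lo hi.
have B0 : 0 < B.+1%:R :> R by [].
have lo0 : 0 <= lo by rewrite floor_ge0 mulr_ge0//; lra.
have lohi : lo < hi.
  by rewrite ltrDr ceil_gt0 mulr_gt0//; lra.
exists `|lo|%N, `|hi|%N; rewrite -!ltz_nat -lez_nat.
rewrite !gez0_abs// ?(le_trans lo0 (ltW lohi))//; split => //.
rewrite -ltzD1 -(ltr_int R) /hi !rmorphD/=.
have := ceilB1_lt (B.+1%:R * (1 - alpha)); rewrite rmorphB /= => ceil_lt.
have floor_le_lo : lo%:~R <= B.+1%:R * (alpha / 2) by exact: floor_le.
have : 0 < B.+1%:R * (alpha / 2) by rewrite mulr_gt0//; lra.
rewrite -!pmulrn; lra.
Qed.

(** * Coverage of the bootstrap interval *)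

Theorem corollary3 (R : realType) (d dZ : measure_display)
  (Omega : measurableType d) (P : probability Omega R)
  (SZ : measurableType dZ) (p : nat)
  (loss : 'rV[R]_p -> SZ -> R) (grad : 'rV[R]_p -> SZ -> 'rV[R]_p)
  (Theta : set 'rV[R]_p) (theta0 init : 'rV[R]_p)
  (Z : {mfun Omega >-> SZ}) (Zs : nat -> {mfun Omega >-> SZ})
  (gamma1 tau alpha : R) (m B : nat)
  (W : nat -> 'I_B -> {RV P >-> R})
  (j : 'I_p) (b0 : 'I_B) (F0 : m.-tuple SZ -> R) :
  measurable_fun [set: p.-tuple R * SZ]
    (fun x => loss (row_of_tuple x.1) x.2) ->
  (forall k : 'I_p, measurable_fun [set: p.-tuple R * SZ]
    (fun x => grad (row_of_tuple x.1) x.2 ord0 k)) ->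
  (forall x z, is_gradient (loss^~ z) x (grad x z) \/
               is_subgradient (loss^~ z) x (grad x z)) ->
  minimizers Theta (fun x => 'E_P[fun w => loss x (Z w)]%E) theta0 ->
  (0 < m)%N -> 0 < gamma1 -> 1 / 2 < tau -> tau < 1 ->
  0 < alpha -> alpha < 1 ->
  let D : Omega -> m.-tuple SZ := fun w => [tuple Zs i.+1 w | i < m] in
  let Wvec (b : 'I_B) : Omega -> m.-tuple R :=
    fun w => [tuple W i.+1 b w | i < m] in
  let Wall : Omega -> B.-tuple (m.-tuple R) :=
    fun w => [tuple Wvec b w | b < B] in
  (forall (i : 'I_m) (b : 'I_B), {ae P, forall w, 0 <= W i.+1 b w}) ->
  (forall (i : 'I_m) (b : 'I_B), ('E_P[W i.+1 b] = 1)%E) ->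
  (forall (i : 'I_m) (b : 'I_B), ('V_P[W i.+1 b] = 1)%E) ->
  (forall (i i' : 'I_m) (b b' : 'I_B),
    identically_distributed P (W i.+1 b) (W i'.+1 b')) ->
  (forall b : 'I_B, mutually_independent P (fun i : 'I_m => W i.+1 b)) ->
  mutually_independent P Wvec ->
  independent P Wall D ->
  let gamma := learning_rate gamma1 tau in
  let thbar (w : Omega) : R :=
    average (sgd grad init gamma (fun n => Zs n w)) m ord0 j in
  let thstar (w : Omega) (b : 'I_B) : R :=
    average (sgd grad init (fun n => gamma n * W n b w) (fun n => Zs n w))
      m ord0 j in
  let th0 : R := theta0 ord0 j in
  let ev (b : 'I_B) : set Omega :=
    [set w | thstar w b <= 2 * thbar w - th0] in
  cond_prob_version P D (ev b0) F0 ->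
  let cover : R :=
    fine (P [set w | bootstrap_CI (thbar w) (thstar w) alpha th0]) in
  let dist : R :=
    ks_dist (pushforward P (F0 \o D)) (uniform_prob (@ltr01 R)) in
  [/\ forall b : 'I_B, cond_prob_version P D (ev b) F0,
      `|cover - (Num.ceil (B.+1%:R * (1 - alpha)))%:~R / B.+1%:R| <= dist &
      - dist <= cover - (1 - alpha) <= 1 / B.+1%:R + dist].
Proof.
move=> _ mgrad _ _ m0 _ _ _ a0 a1 D Wvec Wall _ _ _ idW indW indWvec indWD.
move=> gamma thbar thstar th0 ev [mF0 iF0 F0ev] cover dist.
have mD : measurable_fun setT D.
  apply/measurable_fun_tnthP => i; rewrite (_ : _ \o _ = Zs i.+1)//.
  by apply/funext => w /=; rewrite tnth_mktuple.
have mWvec b : measurable_fun setT (Wvec b).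
  apply/measurable_fun_tnthP => i; rewrite (_ : _ \o _ = W i.+1 b)//.
  by apply/funext => w /=; rewrite tnth_mktuple.
pose Dm : {mfun Omega >-> m.-tuple SZ} :=
  HB.pack D (isMeasurableFun.Build _ _ _ _ _ mD).
pose Wm b : {mfun Omega >-> m.-tuple R} :=
  HB.pack (Wvec b) (isMeasurableFun.Build _ _ _ _ _ (mWvec b)).
have idWm b b' : identically_distributed P (Wm b) (Wm b').
  exact: (identically_distributed_tuple (mWvec b) (mWvec b') (indW b) (indW b')
    (fun i => idW i i b b')).
(* The data and the weights are indexed from 1, tuples from 0. *)
pose o : nat -> 'I_m := fun n => insubd (Ordinal m0) n.-1.
have oS i : (0 < i <= m)%N -> (o i).+1 = i.
  by case: i => // i /andP[_ im]; rewrite /o val_insubd /= im.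
pose z n (u : m.-tuple SZ * m.-tuple R) := tnth u.1 (o n).
pose a n (u : m.-tuple SZ * m.-tuple R) := gamma n * tnth u.2 (o n).
have mz n : measurable_fun setT (z n).
  exact: (measurableT_comp (measurable_tnth (o n))).
have ma n : measurable_fun setT (a n).
  apply: measurable_funM => //.
  exact: (measurableT_comp (measurable_tnth (o n))).
pose bar u := average (fun n => sgd grad init gamma (z^~ u) n) m ord0 j.
pose star u := average (fun n => sgd grad init (a^~ u) (z^~ u) n) m ord0 j.
have mbar : measurable_fun setT bar.
  exact: (measurable_average_sgd init mgrad (a := fun n _ => gamma n)
    (fun n => measurable_cst _) mz m j).
have mstar : measurable_fun setT star.
  exact: (measurable_average_sgd init mgrad ma mz m j).
(* One measurable set of pairs (data, weights) serves all replicates, which brings the events [ev b]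
   into the setting of binomial counts. *)
pose E : set (m.-tuple SZ * m.-tuple R) := [set u | star u <= 2 * bar u - th0].
have mE : measurable E.
  rewrite (_ : E = (fun u => 2 * bar u - th0 - star u) @^-1` `[0, +oo[%classic).
    rewrite -[X in measurable X]setTI.
    suff : measurable_fun setT (fun u => 2 * bar u - th0 - star u) by exact.
    by do 2 ?apply: measurable_funB => //; apply: measurable_funM.
  by apply/seteqP; split => u; rewrite /E /= in_itv/= andbT subr_ge0.
have barE b w : bar (Dm w, Wm b w) = thbar w.
  congr (fun_of_matrix _ _ _); apply: eq_average => i /andP[i0 im].
  apply: eq_sgd => n /andP[n0 ni]; split => //.
  by rewrite /z /= tnth_mktuple oS// n0 (leq_trans ni).
have starE b w : star (Dm w, Wm b w) = thstar w b.
  congr (fun_of_matrix _ _ _); apply: eq_average => i /andP[i0 im].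
  apply: eq_sgd => n /andP[n0 ni].
  by rewrite /z /a /= !tnth_mktuple oS// n0 (leq_trans ni).
have evE b : ev b = [set w | E (Dm w, Wm b w)].
  by rewrite /ev /E /=; under [RHS]eq_set do rewrite starE barE.
pose G := section_prob P Wm b0 E.
have mG : measurable_fun setT G by exact: measurable_section_prob.
have G01 z' : 0 <= G z' <= 1 by exact: section_prob_itv01.
have evG b A : measurable A ->
    P (ev b `&` D @^-1` A) = (\int[P]_(w in D @^-1` A) (G (D w))%:E)%E.
  move=> mA; rewrite evE.
  exact: (section_prob_version (D := Dm) b0 idWm indWD mE b mA).
have version b : cond_prob_version P D (ev b) F0.
  by split => // A mA; rewrite evG// -(evG b0)//; exact: F0ev.
have mGD : measurable_fun setT (G \o Dm) by exact: measurableT_comp.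
(* [F0] is an arbitrary version, whereas [G] is explicit and has values in [0, 1] everywhere. Their
   equality almost everywhere gives [F0 \o D] and [G \o D] the same law, hence the same distance. *)
have FG : ae_eq (distribution P Dm) setT F0 G.
  apply: (cond_prob_version_ae_eq (D := Dm) (E := ev b0)) => //.
  split => // [|A mA]; last by rewrite evG.
  apply: (@le_integrable _ _ _ P _ measurableT _ (cst 1%:E)) => //.
  - exact/measurable_EFinP.
  - move=> w _; have /andP[G0 G1] := G01 (D w).
    by rewrite !abse_EFin lee_fin !ger0_norm.
  - exact: finite_measure_integrable_cst.
pose V : {mfun Omega >-> R} :=
  HB.pack (G \o Dm) (isMeasurableFun.Build _ _ _ _ _ mGD).
have distE : dist = ks_dist (distribution P V) (uniform_prob (@ltr01 R)).
  rewrite /dist /ks_dist; congr (sup _); apply/funext => r /=.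
  congr (exists s, _); apply/funext => s.
  congr (exists t, _); apply/funext => t.
  have -> // : pushforward P (F0 \o D) `]s, t]%classic =
    distribution P V `]s, t]%classic.
  exact: (ae_eq_preimage mF0 mG FG (measurable_itv _)).
have [l [h [loE hiE lh hB]]] : exists l h : nat,
    [/\ Num.floor (B.+1%:R * (alpha / 2)) = l,
      Num.ceil (B.+1%:R * (1 - alpha)) + Num.floor (B.+1%:R * (alpha / 2)) = h,
      (l < h)%N & (h <= B.+1)%N] := quantile_ranks B a0 a1.
have CIE w : bootstrap_CI (thbar w) (thstar w) alpha th0 <->
    (l <= #|[set b | (Dm w, Wm b w) \in E]%SET| < h)%N.
  apply: iff_trans (bootstrap_CIP _ _ alpha th0) _.
  cbv zeta; rewrite hiE loE lez_nat ltz_nat.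
  suff -> : [set b | thstar w b <= 2 * thbar w - th0]%SET =
    [set b | (Dm w, Wm b w) \in E]%SET by [].
  apply/setP => b; rewrite !inE; apply/idP/idP.
    by rewrite -(barE b) -(starE b) => sb; rewrite inE.
  by rewrite inE /E /= -(barE b) -(starE b).
(* The cutoff in [bernstein_win] is invisible here because [G] has values in [0, 1]. *)
have coverE : cover =
    fine (\int[distribution P V]_x (bernstein_win B l h x)%:E)%E.
  rewrite /cover ge0_integral_distribution//; last 2 first.
  - by apply/measurable_EFinP; exact: measurable_bernstein_win.
  - move=> x; rewrite lee_fin.
    by have /andP[] := bernstein_win_itv01 x (ltnW lh) hB.
  congr fine.
  transitivity (P [set w | (l <= #|[set b | (Dm w, Wm b w) \in E]%SET| < h)%N]).
    by congr (P _); apply/seteqP; split => w /CIE.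
  rewrite (prob_success_count (D := Dm) (X := Wm) b0 indWvec idWm indWD mE).
  by apply: eq_integral => w _ /=; rewrite /bernstein_win G01.
have ceilE : (Num.ceil (B.+1%:R * (1 - alpha)))%:~R = (h - l)%:R :> R.
  have -> : Num.ceil (B.+1%:R * (1 - alpha)) = (h - l)%:Z.
    by rewrite -subzn ?(ltnW lh)// -hiE -loE addrK.
  by [].
have bound :
    `|cover - (Num.ceil (B.+1%:R * (1 - alpha)))%:~R / B.+1%:R| <= dist.
  rewrite ceilE coverE distE.
  (* The index [b0] forces [B] to be positive, so [B] has the successor form required of the
     degree. *)
  have B_gt0 : (0 < B)%N := leq_ltn_trans (leq0n b0) (ltn_ord b0).
  have := bernstein_win_ks_dist (distribution P V) (n := B.-1) lh.
  by rewrite prednK// => /(_ hB).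
split => //.
move: bound; rewrite ler_norml => /andP[bl bu].
have B0 : 0 < B.+1%:R :> R by [].
(* Rounding up moves the nominal level by at most 1 / (B + 1). *)
have c1 : 1 - alpha <= (Num.ceil (B.+1%:R * (1 - alpha)))%:~R / B.+1%:R.
  by rewrite ler_pdivlMr// mulrC ceil_ge.
have c2 : (Num.ceil (B.+1%:R * (1 - alpha)))%:~R / B.+1%:R <=
    1 - alpha + 1 / B.+1%:R.
  rewrite ler_pdivrMr// mulrDl divfK ?gt_eqF// mulrC -lerBlDr ltW//.
  by have := ceilB1_lt ((1 - alpha) * B.+1%:R); rewrite rmorphB.
apply/andP; split; first by apply: le_trans bl _; rewrite lerD2l lerN2.
have := lerD bu c2; rewrite subrK lerBlDr => /le_trans; apply.
by rewrite [leRHS]addrAC [leRHS]addrC [1 / _ + _]addrC.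
Qed.
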